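(* Let $d\ge1$, $1\le j\le d$, and let $\{a_n\}_{n\ge0}$ be a sequence of nonnegative real numbers. Suppose that $L=\lim_{n\to\infty}(n+1)a_n$ exists in $[0,\infty]$. Let $R_{(j,a_n)}$ be the associated Rhaly-type operator on the Drury-Arveson space $H^2_d(\mathbb{B}_d)$. (i) If $L<\infty$, then $R_{(j,a_n)}$ is bounded. (ii) If $L=\infty$, then $R_{(j,a_n)}$ is unbounded. (iii) If $L=0$, then $R_{(j,a_n)}$ is compact.
   Context: Multi-index notation: for $\alpha=(\alpha_1,\dots,\alpha_d)\in\mathbb{N}^d$ (with $0\in\mathbb{N}$), $z^\alpha=\prod_i z_i^{\alpha_i}$, $\alpha!=\prod_i\alpha_i!$, $|\alpha|=\sum_i\alpha_i$. The Drury-Arveson space $H^2_d=H^2_d(\mathbb{B}_d)$ is the reproducing kernel Hilbert space of analytic functions on the unit ball $\mathbb{B}_d\subset\mathbb{C}^d$ with kernel $k(z,w)=\frac{1}{1-\langle z,w\rangle}$. Equivalently, it consists of the power series $f(z)=\sum_\alpha c_\alpha z^\alpha$ with $\|f\|^2=\sum_\alpha |c_\alpha|^2\frac{\alpha!}{|\alpha|!}<\infty$, with inner product $\langle f,g\rangle=\sum_\alpha\frac{\alpha!}{|\alpha|!}c_\alpha\overline{d_\alpha}$ for $g=\sum_\alpha d_\alpha z^\alpha$. Each $f\in H^2_d$ has a homogeneous expansion $f=\sum_{n\ge0}f_n$ with $f_n(z)=\sum_{|\alpha|=n}c_\alpha z^\alpha$. Given a complex sequence $\{a_n\}_{n\ge0}$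 and $1\le j\le d$, the Rhaly-type operator $R_{(j,a_n)}$ is defined by $$R_{(j,a_n)}f=\sum_{n=0}^\infty a_n\sum_{m=0}^n z_j^{\,n-m}f_m = a_0f_0+a_1(z_jf_0+f_1)+a_2(z_j^2f_0+z_jf_1+f_2)+\cdots,$$ understood as a formal series of homogeneous polynomials. The operator is called bounded if $R_{(j,a_n)}f\in H^2_d$ for all $f\in H^2_d$ and there is $M>0$ with $\|R_{(j,a_n)}f\|\le M\|f\|$ for all $f\in H^2_d$. Otherwise it is called unbounded. *)

(* Defs.v *)
From HB Require Import structures.
From mathcomp Require Import all_boot all_order all_algebra.
From mathcomp Require Import all_classical all_reals all_analysis.
From mathcomp Require Import complex ring lra zify.

Set Implicit Arguments.
Unset Strict Implicit.
Unset Printing Implicit Defensive.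

Import Order.TTheory GRing.Theory Num.Theory.
Import ComplexField.Normc.

Local Open Scope classical_set_scope.
Local Open Scope ring_scope.

Definition mindex (d : nat) := {ffun 'I_d -> nat}.

Definition mdeg d (al : mindex d) : nat := (\sum_(i < d) al i)%N.

Definition mfact d (al : mindex d) : nat := (\prod_(i < d) (al i)`!)%N.

(* The formal power series with coefficients c_al is the function al |-> c_al;
   its C-vector space structure is the pointwise one. *)
Notation fps R d := (mindex d -> R[i]).

Section DruryArvesonSpace.
Variables (R : realType) (d : nat).
Implicit Types (al : mindex d) (f g : fps R d).

(* An element of the Drury-Arveson space is identified with the family of its
   Taylor coefficients: the space consists of the power series with
   \sum_al |c_al|^2 al! / |al|! < +oo. *)
Definition da_weight al : R := (mfact al)%:R / ((mdeg al)`!)%:R.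

Definition da_sqnorm f : \bar R :=
  \esum_(al in [set: mindex d]) (normc (f al) ^+ 2 * da_weight al)%:E.

Definition da_norm f : R := Num.sqrt (fine (da_sqnorm f)).

Definition in_da : {pred fps R d} := [pred f | (da_sqnorm f < +oo)%E].

Lemma da_weight_gt0 al : 0 < da_weight al.
Proof.
by rewrite divr_gt0// ltr0n ?fact_gt0// prodn_gt0// => i; rewrite fact_gt0.
Qed.

Let term_ge0 f al : (0 <= (normc (f al) ^+ 2 * da_weight al)%:E)%E.
Proof. by rewrite lee_fin mulr_ge0 ?sqr_ge0// ltW ?da_weight_gt0. Qed.

Lemma da_sqnorm_ge0 f : (0 <= da_sqnorm f)%E.
Proof. by apply: esum_ge0 => al _; exact: term_ge0. Qed.

Lemma da_sqnorm_fin f : f \in in_da -> da_sqnorm f \is a fin_num.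
Proof. by move=> ff; rewrite ge0_fin_numE ?da_sqnorm_ge0. Qed.

Lemma sqr_da_norm f : f \in in_da -> (da_norm f ^+ 2)%:E = da_sqnorm f.
Proof.
move=> ff; rewrite sqr_sqrtr ?fineK ?da_sqnorm_fin//.
by rewrite fine_ge0 ?da_sqnorm_ge0.
Qed.

Lemma da_norm_ge0 f : 0 <= da_norm f.
Proof. exact: sqrtr_ge0. Qed.

Let esum_scale (c : R) (u : mindex d -> \bar R) : 0 <= c ->
  (forall al, 0 <= u al)%E ->
  (\esum_(al in setT) (c%:E * u al) <= c%:E * \esum_(al in setT) u al)%E.
Proof.
move=> c0 u0; apply: ge_ereal_sup => _ [A sA <-].
rewrite -ge0_mule_fsumr//; apply: lee_wpmul2l => //.
by apply: ereal_sup_ubound; exists A.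
Qed.

Lemma da_sqnormD (s : R) f g : 0 < s ->
  (da_sqnorm (f + g)%R
     <= (1 + s)%:E * da_sqnorm f + (1 + s^-1)%:E * da_sqnorm g)%E.
Proof.
move=> s0; have s'0 : 0 < s^-1 by rewrite invr_gt0.
pose u f al := (normc (f al) ^+ 2 * da_weight al)%:E.
apply: (@le_trans _ _ (\esum_(al in setT)
  ((1 + s)%:E * u f al + (1 + s^-1)%:E * u g al))%E); last first.
  have cu (c : R) h al : 0 <= c -> (0 <= c%:E * u h al)%E.
    by move=> c0; rewrite mule_ge0 ?lee_fin//; exact: term_ge0.
  rewrite esumD; last 2 first.
  - by move=> al _; apply: cu; lra.
  - by move=> al _; apply: cu; lra.
  by apply: leeD; apply: esum_scale => [|al]; rewrite ?term_ge0//; lra.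
apply: le_esum => al _; rewrite /u -!EFinM -EFinD lee_fin.
have := da_weight_gt0 al; move: (da_weight al) => w /ltW w0.
have n0 (x : R[i]) : 0 <= normc x by case: x => x y; exact: sqrtr_ge0.
have : normc ((f + g) al) <= normc (f al) + normc (g al) by exact: le_normcD.
have := n0 ((f + g) al); have := n0 (f al); have := n0 (g al).
move: (normc (f al)) (normc (g al)) (normc ((f + g) al)) => a b c b0 a0 c0 cab.
apply: (@le_trans _ _ ((a + b) ^+ 2 * w)).
  by rewrite ler_wpM2r// lerXn2r ?nnegrE ?addr_ge0//.
rewrite -subr_ge0 [leRHS](_ : _ = w * (s^-1 * (s * a - b) ^+ 2)).
  by apply: mulr_ge0 => //; apply: mulr_ge0; rewrite ?sqr_ge0// ltW.
by field; rewrite gt_eqF.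
Qed.

Let da_sqnormZ_le (c : R[i]) f :
  (da_sqnorm (c *: f)%R <= (normc c ^+ 2)%:E * da_sqnorm f)%E.
Proof.
apply: le_trans (esum_scale (sqr_ge0 _) (fun al => term_ge0 f al)).
apply: le_esum => al _; rewrite -EFinM lee_fin; move: (da_weight al) => w.
by rewrite -[(c *: f) al]/(c * f al) normcM exprMn -mulrA.
Qed.

Lemma da_sqnormZ (c : R[i]) f :
  da_sqnorm (c *: f) = ((normc c ^+ 2)%:E * da_sqnorm f)%E.
Proof.
apply/eqP; rewrite eq_le da_sqnormZ_le/=.
have [->|c0] := eqVneq c 0.
  by rewrite normc0 expr0n mul0e da_sqnorm_ge0.
have nc0 : 0 < normc c ^+ 2.
  rewrite exprn_even_gt0//; apply: contra_neq c0; exact: eq0_normc.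
have := da_sqnormZ_le c^-1 (c *: f).
rewrite scalerA mulVf// scale1r normcV exprVn => /(lee_wpmul2l _).
move=> /(_ (normc c ^+ 2)%:E); rewrite lee_fin sqr_ge0 => /(_ isT).
by rewrite muleA -EFinM divff ?mul1e// gt_eqF.
Qed.

Lemma in_da_submod_closed : submod_closed in_da.
Proof.
split=> [|c f g]; rewrite !inE.
  rewrite /da_sqnorm esum1 ?ltry// => al _.
  by rewrite normc0 expr0n mul0r.
move=> ff gf; apply: le_lt_trans (da_sqnormD _ _ ltr01) _.
rewrite da_sqnormZ lte_add_pinfty// ?lte_mul_pinfty ?lee_fin//;
  by rewrite ?mule_ge0 ?da_sqnorm_ge0 ?lee_fin ?sqr_ge0 ?lte_mul_pinfty
             ?lee_fin ?sqr_ge0.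
Qed.

HB.instance Definition _ :=
  GRing.isSubmodClosed.Build _ _ in_da in_da_submod_closed.

Record druryArveson := DruryArveson {
  da_series :> fps R d;
  da_seriesP : da_series \in in_da }.

HB.instance Definition _ := [isSub for da_series].
HB.instance Definition _ := [Choice of druryArveson by <:].
HB.instance Definition _ := [SubChoice_isSubLmodule of druryArveson by <:].

Lemma da_norm_eq0 f : f \in in_da -> da_norm f = 0 -> f = 0.
Proof.
move=> ff f0; apply/funext => al; apply: eq0_normc.
have : ((normc (f al) ^+ 2 * da_weight al)%:E <= da_sqnorm f)%E.
  apply: ereal_sup_ubound; exists [set al]; last exact: fsbig_set1.
  by split=> //; exact: finite_set1.
rewrite -sqr_da_norm// f0 expr0n/= lee_fin pmulr_lle0 ?da_weight_gt0// => n0.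
by apply/eqP; rewrite -sqrf_eq0 eq_le n0 sqr_ge0.
Qed.

Lemma da_normZ (c : R[i]) f : f \in in_da ->
  da_norm (c *: f) = normc c * da_norm f.
Proof.
move=> ff; rewrite /da_norm da_sqnormZ fineM ?da_sqnorm_fin//= sqrtrM ?sqr_ge0//.
by rewrite sqrtr_sqr ger0_norm//; case: c => x y; exact: sqrtr_ge0.
Qed.

Lemma da_normD f g : f \in in_da -> g \in in_da ->
  da_norm (f + g) <= da_norm f + da_norm g.
Proof.
move=> ff gf.
have [f0|f0] := eqVneq (da_norm f) 0.
  by rewrite (da_norm_eq0 ff f0) add0r lerDr da_norm_ge0.
have [g0|g0] := eqVneq (da_norm g) 0.
  by rewrite (da_norm_eq0 gf g0) addr0 lerDl da_norm_ge0.
have fgf : f + g \in in_da by exact: rpredD.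
have a0 : 0 < da_norm f by rewrite lt_neqAle eq_sym f0 da_norm_ge0.
have b0 : 0 < da_norm g by rewrite lt_neqAle eq_sym g0 da_norm_ge0.
have := da_sqnormD f g (divr_gt0 b0 a0).
rewrite -!sqr_da_norm// -!EFinM -EFinD lee_fin => h.
rewrite -(@ler_pXn2r _ 2)// ?nnegrE ?addr_ge0 ?da_norm_ge0//.
apply: le_trans h _; rewrite le_eqVlt; apply/orP; left; apply/eqP.
by field; rewrite f0 g0.
Qed.

Definition da_normC (f : druryArveson) : R[i] := (da_norm f)%:C%C.

Let da_normCD (f g : druryArveson) :
  da_normC (f + g) <= da_normC f + da_normC g.
Proof.
by rewrite /da_normC -rmorphD lecR; apply: da_normD; exact: da_seriesP.
Qed.

Let da_normCZ (c : R[i]) (f : druryArveson) :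
  da_normC (c *: f) = `|c| * da_normC f.
Proof.
rewrite /da_normC -[da_series (c *: f)]/(c *: da_series f).
by rewrite da_normZ ?da_seriesP// rmorphM.
Qed.

Let da_normC_eq0 (f : druryArveson) : da_normC f = 0 -> f = 0.
Proof.
by move=> [/(da_norm_eq0 (da_seriesP f)) f0]; apply/val_inj.
Qed.

HB.instance Definition _ := @Lmodule_isNormed.Build R[i] druryArveson
  da_normC da_normCD da_normCZ da_normC_eq0.

Lemma da_normE (f : druryArveson) : `|f| = (da_norm f)%:C%C.
Proof. by []. Qed.

End DruryArvesonSpace.

Section Rhaly.
Variables (R : realType) (d : nat).
Implicit Types (al : mindex d) (f : fps R d) (j : 'I_d) (a : nat -> R[i]).

Definition homog (n : nat) f : fps R d :=
  fun al => if mdeg al == n then f al else 0.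

(* multiplication by z_j^k *)
Definition mulzX j (k : nat) f : fps R d :=
  fun al => if (k <= al j)%N
            then f [ffun i => if i == j then (al i - k)%N else al i] else 0.

Definition rhaly_homog j a (n : nat) f : fps R d :=
  a n *: \sum_(0 <= m < n.+1) mulzX j (n - m) (homog m f).

(* [rhaly_homog j a n f] is homogeneous of degree n (lemma [homog_rhaly]), so it
   is the only term of the formal series contributing to degree n. *)
Definition rhaly j a f : fps R d := fun al => rhaly_homog j a (mdeg al) f al.

Lemma homog_rhaly j a n f : homog n (rhaly j a f) = rhaly_homog j a n f.
Proof.
apply/funext => al; rewrite /homog; case: eqP => [<-//|aln].
rewrite /rhaly_homog -[RHS]/(a n * (\sum_(0 <= m < n.+1) _) al).
rewrite fct_sumE big_nat big1 ?mulr0// => m /andP[_ mn].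
rewrite /mulzX /homog; case: ifPn => // kal; case: eqP => // dm; case: aln.
have dE (be : mindex d) : mdeg be = (be j + \sum_(i < d | i != j) be i)%N.
  by rewrite /mdeg (bigD1 j).
rewrite dE; move: dm kal mn; rewrite dE ffunE eqxx.
under eq_bigr => i /negPf ij do rewrite ffunE ij.
move: (al j) (\sum_(i < d | i != j) al i)%N => x s; lia.
Qed.

(* The finiteness of the norm of [T f] is the first conjunct: [da_norm] is a
   junk value outside [in_da]. *)
Definition da_bounded (T : fps R d -> fps R d) : Prop :=
  (forall f, f \in @in_da R d -> T f \in @in_da R d) /\
  exists2 M : R, 0 < M &
    forall f, f \in @in_da R d -> da_norm (T f) <= M * da_norm f.

(* T restricts to a compact operator on the Drury-Arveson space; the space is
   Hausdorff, so [precompact] means having a compact closure. *)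
Definition da_compact (T : fps R d -> fps R d) : Prop :=
  exists2 S : {linear druryArveson R d -> druryArveson R d},
    (forall f : druryArveson R d, S f = T f :> fps R d) &
    forall A : set (druryArveson R d), bounded_set A -> precompact (S @` A).

End Rhaly.

(* Main.v *)
From HB Require Import structures.
Require Import Defs.
From mathcomp Require Import all_boot all_order all_algebra finmap.
From mathcomp Require Import all_classical all_reals all_analysis.
From mathcomp Require Import complex ring lra zify.

Set Implicit Arguments.
Unset Strict Implicit.
Unset Printing Implicit Defensive.

Import Order.TTheory GRing.Theory Num.Theory.
Import numFieldNormedType.Exports.
Import ComplexField.Normc.

Local Open Scope classical_set_scope.
Local Open Scope ring_scope.

(* On coefficients, [(R f)(al) = a_|al| * \sum_(k <= al j) f (al - k e_j)], so R
   is a Cesaro-like operator on each line of multi-indices in the direction e_j.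
   The weights al!/|al|! decrease along these lines and al j <= |al|, so a bound
   (n + 1) |a_n| <= C reduces boundedness to Hardy's inequality, proved by a
   Schur test with weights sqrt (l + 1).  The same estimate with C replaced by
   the supremum of (n + 1) |a_n| over n >= N makes the tail of R small when
   L = 0, while the remaining part depends on finitely many coefficients only;
   hence R is continuous from a ball with the topology of coefficientwise
   convergence, which is compact by Tychonoff, to the norm topology.  When
   L = +oo, the polynomials 1 + z_j + ... + z_j^(n-1) show that R is
   unbounded. *)

(** * Shifts of multi-indices along the direction e_j *)

Section MultiIndexShift.
Variables (d : nat) (j : 'I_d).
Implicit Types (al be : mindex d) (k : nat).

Definition madd k al : mindex d :=
  [ffun i => if i == j then (al i + k)%N else al i].

Definition msub k al : mindex d :=
  [ffun i => if i == j then (al i - k)%N else al i].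

Lemma maddK k al : msub k (madd k al) = al.
Proof.
by apply/ffunP => i; rewrite !ffunE; case: eqP => // _; rewrite addnK.
Qed.

Lemma msubK k al : (k <= al j)%N -> madd k (msub k al) = al.
Proof.
move=> kal; apply/ffunP => i; rewrite !ffunE; case: eqP => // ->.
by rewrite subnK.
Qed.

Lemma madd_j k al : madd k al j = (al j + k)%N.
Proof. by rewrite ffunE eqxx. Qed.

Lemma msub_j k al : msub k al j = (al j - k)%N.
Proof. by rewrite ffunE eqxx. Qed.

Lemma maddS k al : madd k.+1 al = madd 1 (madd k al).
Proof. by apply/ffunP => i; rewrite !ffunE; case: eqP => // _; lia. Qed.

Lemma madd0 al : madd 0 al = al.
Proof. by apply/ffunP => i; rewrite !ffunE addn0 if_same. Qed.

Lemma mdeg_madd k al : mdeg (madd k al) = (mdeg al + k)%N.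
Proof.
rewrite /mdeg (bigD1 j)//= [in RHS](bigD1 j)//= madd_j addnAC.
by congr (_ + _ + _)%N; apply: eq_bigr => i /negPf ij; rewrite ffunE ij.
Qed.

Lemma mdeg_ge al : (al j <= mdeg al)%N.
Proof. by rewrite /mdeg (bigD1 j)//= leq_addr. Qed.

Lemma mdeg_msub k al : (k <= al j)%N -> mdeg (msub k al) = (mdeg al - k)%N.
Proof. by move=> kal; rewrite -{2}(msubK kal) mdeg_madd addnK. Qed.

Lemma mfact_madd1 al : mfact (madd 1 al) = ((al j).+1 * mfact al)%N.
Proof.
rewrite /mfact (bigD1 j)//= [in RHS](bigD1 j)//= madd_j addn1 factS -mulnA.
by congr (_ * (_ * _))%N; apply: eq_bigr => i /negPf ij; rewrite ffunE ij.
Qed.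

(** Every entry is at most the degree, so such indices come from functions into a finite type. *)
Lemma finite_mdeg_lt k : finite_set [set al : mindex d | (mdeg al < k)%N].
Proof.
pose e (u : {ffun 'I_d -> 'I_k.+1}) : mindex d := [ffun i => nat_of_ord (u i)].
apply: (sub_finite_set _ (finite_image e (@finite_finset _ setT))).
move=> al /= alk; exists [ffun i => inord (al i)] => //.
apply/ffunP => i; rewrite !ffunE inordK// ltnS ltnW//.
by apply: leq_ltn_trans alk; rewrite /mdeg (bigD1 i)//= leq_addr.
Qed.

Lemma set_bij_madd : set_bij (setT `*`` (fun _ : mindex d => setT))
  (setT `*`` (fun al => `I_(al j).+1)) (fun p => (madd p.2 p.1, p.2)).
Proof.
split=> [[be k] _|[be k] [be' k'] _ _ /= [e kk]|[al k] [_ /= kal]].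
- by split=> //=; rewrite madd_j ltnS leq_addl.
- by move: e; rewrite -kk => /(congr1 (msub k)); rewrite !maddK => ->.
- by exists (msub k al, k) => //=; rewrite msubK.
Qed.

(** Tonelli for nonnegative terms: the pairs (al, k) with k <= al j are regrouped by the base point
    be = al - k e_j, through the bijection [set_bij_madd]. *)
Lemma esum_madd (R : realType) (G : mindex d -> nat -> \bar R) :
  (forall be k, (0 <= G be k)%E) ->
  (\esum_(al in [set: mindex d]) \sum_(0 <= k < (al j).+1) G (msub k al) k =
   \esum_(be in [set: mindex d]) \esum_(k in setT) G be k)%E.
Proof.
move=> G0; rewrite [RHS]esum_esum//.
transitivity (\esum_(al in [set: mindex d])
    \esum_(k in `I_(al j).+1) G (msub k al) k)%E.
  apply: eq_esum => al _; rewrite esum_fset//.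
  by rewrite -fsbig_ord big_mkord.
rewrite esum_esum//.
rewrite (@reindex_esum _ _ _ _ _ _ _ set_bij_madd).
by apply: eq_esum => -[be k] _ /=; rewrite maddK.
Qed.

End MultiIndexShift.

(** * Monotonicity of the weights along e_j *)

Section Weight.
Variables (R : realType) (d : nat) (j : 'I_d).

(** One step along e_j multiplies the weight by (al j + 1) / (|al| + 1) <= 1. *)
Lemma le_da_weight_madd k (al : mindex d) :
  da_weight R (madd j k al) <= da_weight R al.
Proof.
elim: k => [|k IH]; first by rewrite madd0.
apply: le_trans IH; rewrite maddS; move: (madd j k al) => be.
rewrite /da_weight mfact_madd1 mdeg_madd addn1 factS.
rewrite ler_pdivrMr ?ltr0n ?muln_gt0 ?fact_gt0// natrM.
have [w0 fN] :
    0 <= (mfact be)%:R / (mdeg be)`!%:R :> R /\ (mdeg be)`!%:R != 0 :> R.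
  by rewrite divr_ge0// pnatr_eq0 -lt0n fact_gt0.
rewrite [in leRHS]natrM mulrCA divfK// ler_wpM2r// ler_nat ltnS.
exact: mdeg_ge.
Qed.

End Weight.

(** * The two inequalities of the Schur test *)

Section Hardy.
Variable R : rcfType.

(** This is Cauchy-Schwarz with weights sqrt (l + 1), combined with the bound 2 sqrt (k + 1) for the
    sum of the 1 / sqrt (l + 1); a single induction on k gives both. *)
Lemma sqr_sum_le_sqrt (b : nat -> R) k :
  (\sum_(0 <= l < k.+1) b l) ^+ 2 <=
  2 * Num.sqrt k.+1%:R * \sum_(0 <= l < k.+1) Num.sqrt l.+1%:R * b l ^+ 2.
Proof.
elim: k => [|k IH].
  rewrite !big_nat1 sqrtr1 mulr1 mul1r; have := sqr_ge0 (b 0%N); lra.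
rewrite big_nat_recr//= [in leRHS]big_nat_recr//=.
move: IH; move: (\sum_(0 <= l < k.+1) b l) (b k.+1) => S x.
move: (\sum_(0 <= l < k.+1) _) => A.
have k0 : 0 < k.+1%:R :> R by rewrite ltr0n.
have s0 : 0 < Num.sqrt k.+1%:R :> R by rewrite sqrtr_gt0.
have st : Num.sqrt k.+1%:R < Num.sqrt k.+2%:R :> R.
  by rewrite ltr_sqrt ?ltr0n// ltr_nat.
have s2 : Num.sqrt k.+1%:R ^+ 2 = k.+1%:R :> R by rewrite sqr_sqrtr// ltW.
have t2 : Num.sqrt k.+2%:R ^+ 2 = k.+1%:R + 1 :> R.
  by rewrite sqr_sqrtr// natr1.
move: s0 st s2 t2; move: (Num.sqrt k.+1%:R) (Num.sqrt k.+2%:R) => s t.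
move=> s0 st s2 t2 IH.
have ts : (t - s) * (t + s) = 1 by rewrite -subr_sqr t2 s2; ring.
have e0 : 0 < t - s by rewrite subr_gt0.
(* Young's inequality (S + x)^2 <= (1 + q) S^2 + (1 + 1/q) x^2 with q = (t - s) / s, chosen so that
   1 + q = t / s turns the factor 2 s of the induction hypothesis into 2 t. *)
have h1 : (S + x) ^+ 2 <= t / s * S ^+ 2 + t / (t - s) * x ^+ 2.
  rewrite -subr_ge0 [leRHS](_ : _ = ((t - s) * S - s * x) ^+ 2 / (s * (t - s))).
    by rewrite divr_ge0 ?sqr_ge0// mulr_ge0 ?ltW.
  by field; rewrite !gt_eqF.
apply: le_trans h1 _; rewrite mulrDr; apply: lerD.
  rewrite (_ : 2 * t * A = t / s * (2 * s * A)); last by field; rewrite gt_eqF.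
  by rewrite ler_wpM2l// divr_ge0 ?ltW// (lt_trans s0).
rewrite mulrA ler_wpM2r ?sqr_ge0//.
(* Since t^2 - s^2 = 1, the coefficient of x^2 is t (t + s), at most 2 t^2. *)
rewrite (_ : (t - s)^-1 = t + s); last first.
  by apply: (mulfI (lt0r_neq0 e0)); rewrite ts divff// gt_eqF.
nra.
Qed.

(** Each term is at most the telescoping difference 4 (n^(-1/2) - (n+1)^(-1/2)). With s^2 = n and
    t^2 = n + 1, this amounts to t (t + s) <= 4 s^2, which follows from t^2 <= 2 s^2. *)
Lemma sum_inv_pow32_le m K :
  \sum_(0 <= k < K) (Num.sqrt (m + k).+1%:R ^+ 3)^-1 <=
  4 * (Num.sqrt m.+1%:R)^-1 :> R.
Proof.
apply: (@le_trans _ _ (\sum_(0 <= k < K)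
   (4 * (Num.sqrt (m + k).+1%:R)^-1 - 4 * (Num.sqrt (m + k.+1).+1%:R)^-1))).
  apply: ler_sum => k _; rewrite addnS; move: (m + k)%N => {K m k}n.
  have n0 : 1 <= n.+1%:R :> R by rewrite ler1n.
  have s0 : 0 < Num.sqrt n.+1%:R :> R by rewrite sqrtr_gt0 ltr0n.
  have st : Num.sqrt n.+1%:R < Num.sqrt n.+2%:R :> R.
    by rewrite ltr_sqrt ?ltr0n// ltr_nat.
  have s2 : Num.sqrt n.+1%:R ^+ 2 = n.+1%:R :> R by rewrite sqr_sqrtr// ler0n.
  have t2 : Num.sqrt n.+2%:R ^+ 2 = n.+1%:R + 1 :> R.
    by rewrite sqr_sqrtr ?ler0n// natr1.
  move: n0 s0 st s2 t2.
  move: n.+1%:R (Num.sqrt n.+1%:R) (Num.sqrt n.+2%:R) => N s t.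
  move=> N1 s0 st s2 t2.
  have t0 : 0 < t by lra.
  have ts : (t - s) * (t + s) = 1 by rewrite -subr_sqr t2 s2; ring.
  rewrite -subr_ge0.
  rewrite (_ : _ - _ = (4 * s ^+ 2 * (t - s) - t) / (t * s ^+ 3)); last first.
    by field; rewrite !gt_eqF.
  apply: divr_ge0; last by rewrite mulr_ge0 ?exprn_ge0// ltW.
  rewrite subr_ge0.
  rewrite -(ler_pM2r (_ : 0 < t + s)); last by lra.
  rewrite -[leRHS]mulrA ts mulr1 mulrDr -expr2.
  nra.
rewrite (@telescope_sumr_eq _ _ _
  (fun k => - (4 * (Num.sqrt (m + k).+1%:R)^-1)))//.
  by rewrite addn0 opprK gerDr oppr_le0 mulr_ge0// invr_ge0 sqrtr_ge0.
by move=> k _; rewrite opprK addrC.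
Qed.
End Hardy.

Lemma normc_real (R : rcfType) (x : R) : normc x%:C%C = `|x|.
Proof. by rewrite /normc/= expr0n addr0 sqrtr_sqr. Qed.

(** * The squared-norm estimate for the Rhaly operator *)

Section RhalyBound.
Variables (R : realType) (d : nat) (j : 'I_d).
Implicit Types (f : fps R d) (al : mindex d) (a : nat -> R[i]).

(** Substitute m = |al| - k: the terms with k > al j vanish because z_j^k does not divide z^al, and
    in the others al - k e_j has degree m, so the homogeneous projection has no effect. *)
Lemma rhalyE a f al :
  rhaly j a f al = a (mdeg al) * \sum_(0 <= k < (al j).+1) f (msub j k al).
Proof.
rewrite /rhaly /rhaly_homog -[LHS]/(a _ * (\sum_(0 <= m < _) _) al).
congr (_ * _); rewrite fct_sumE big_nat_rev/= add0n.
rewrite (@big_cat_nat _ _ _ (al j).+1)//= ?ltnS ?mdeg_ge//.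
rewrite [X in _ + X]big_nat [X in _ + X]big1 ?addr0; last first.
  move=> k /andP[jk kn]; rewrite subSS subKn// /mulzX ifF//.
  by apply/negbTE; rewrite -ltnNge.
apply: eq_big_nat => k /=; rewrite ltnS => kj.
have kn := leq_trans kj (mdeg_ge j al).
by rewrite subSS subKn// /mulzX kj /homog mdeg_msub// eqxx.
Qed.

Lemma normc_ge0 (x : R[i]) : 0 <= normc x.
Proof. by case: x => x y; exact: sqrtr_ge0. Qed.

Lemma le_normc_sum (I : Type) (r : seq I) (F : I -> R[i]) :
  normc (\sum_(i <- r) F i) <= \sum_(i <- r) normc (F i).
Proof.
elim/big_ind2 : _ => [|x u y v xu yv|//]; first by rewrite normc0.
exact: le_trans (le_normcD _ _) (lerD xu yv).
Qed.

(** As al j <= |al|, the factor |a_|al|| is at most C / (al j + 1); with [sqr_sum_le_sqrt] this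
    produces 2 C^2 (al j + 1)^(-3/2). The right side is written through al - k e_j and k alone, the
    form that [esum_madd] regroups. *)
Lemma rhaly_term_le a (C : R) f al :
  (forall n, n.+1%:R * normc (a n) <= C) ->
  normc (rhaly j a f al) ^+ 2 * da_weight R al <=
  \sum_(0 <= k < (al j).+1) 2 * C ^+ 2 *
     (Num.sqrt (msub j k al j + k).+1%:R ^+ 3)^-1 *
     Num.sqrt (msub j k al j).+1%:R *
     (normc (f (msub j k al)) ^+ 2 * da_weight R (msub j k al)).
Proof.
move=> aC; set N := al j.
have w0 : 0 < da_weight R al by exact: da_weight_gt0.
have N0 : 0 < N.+1%:R :> R by rewrite ltr0n.
have C0 : 0 <= C by apply: le_trans (aC 0%N); rewrite mulr_ge0 ?normc_ge0.
have aN : normc (a (mdeg al)) <= C / N.+1%:R.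
  rewrite ler_pdivlMr// mulrC; apply: le_trans (aC (mdeg al)).
  by rewrite ler_wpM2r ?normc_ge0// ler_nat ltnS mdeg_ge.
have s0 : 0 < Num.sqrt N.+1%:R :> R by rewrite sqrtr_gt0.
have s2 : Num.sqrt N.+1%:R ^+ 2 = N.+1%:R :> R by rewrite sqr_sqrtr// ltW.
have S0 : 0 <= \sum_(0 <= k < N.+1) normc (f (msub j k al)).
  by apply: sumr_ge0 => k _; exact: normc_ge0.
apply: (@le_trans _ _ ((C / N.+1%:R) ^+ 2 *
    (\sum_(0 <= k < N.+1) normc (f (msub j k al))) ^+ 2 * da_weight R al)).
  rewrite ler_wpM2r ?(ltW w0)// rhalyE normcM exprMn.
  apply: ler_pM; rewrite ?sqr_ge0//.
    by rewrite lerXn2r ?nnegrE ?normc_ge0// divr_ge0// ltW.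
  by rewrite lerXn2r ?nnegrE ?normc_ge0// le_normc_sum.
(* After reversal the summation index is the j-th entry of the shifted multi-index, on which the
   weights sqrt (l + 1) depend. *)
rewrite big_nat_rev/= add0n.
have h := sqr_sum_le_sqrt (fun k => normc (f (msub j (N - k) al))) N.
rewrite [X in _ * X ^+ 2 * _](_ : _ =
    \sum_(0 <= k < N.+1) normc (f (msub j (N - k) al))); last first.
  by apply: eq_bigr => k _; rewrite subSS.
apply: (@le_trans _ _ ((C / N.+1%:R) ^+ 2 *
    (2 * Num.sqrt N.+1%:R * \sum_(0 <= k < N.+1)
       Num.sqrt k.+1%:R * normc (f (msub j (N - k) al)) ^+ 2) *
    da_weight R al)).
  by rewrite ler_wpM2r ?(ltW w0)// ler_wpM2l ?sqr_ge0.
rewrite (mulrA (_ ^+ 2)) -(mulrA _ _ (da_weight R al)).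
rewrite mulr_suml mulr_sumr big_nat_rev/= add0n.
rewrite [leLHS]big_nat [leRHS]big_nat; apply: ler_sum => k.
rewrite ltnS => /= kN.
rewrite subSS msub_j subnK// subKn//.
move: s0 s2; move: (Num.sqrt N.+1%:R) => s s0 <-.
rewrite [leLHS](_ : _ = 2 * C ^+ 2 * (s ^+ 3)^-1 * Num.sqrt (N - k).+1%:R *
    (normc (f (msub j k al)) ^+ 2 * da_weight R al)); last first.
  move: (normc _) (Num.sqrt _) (da_weight R al) => x y z.
  by field; rewrite gt_eqF.
rewrite ler_wpM2l//.
  by rewrite !mulr_ge0 ?sqr_ge0 ?sqrtr_ge0// invr_ge0 exprn_ge0// ltW.
by rewrite ler_wpM2l ?sqr_ge0// -{1}(msubK kN) le_da_weight_madd.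
Qed.

(** After the exchange of sums, the sum over k at a fixed base point be is at most 2 C^2 sqrt (be j
    + 1) times 4 / sqrt (be j + 1), by [sum_inv_pow32_le]. *)
Lemma da_sqnorm_rhaly_le a (C : R) f :
  (forall n, n.+1%:R * normc (a n) <= C) ->
  (da_sqnorm (rhaly j a f) <= (8 * C ^+ 2)%:E * da_sqnorm f)%E.
Proof.
move=> aC.
pose g al := normc (f al) ^+ 2 * da_weight R al.
have g0 al : 0 <= g al by rewrite mulr_ge0 ?sqr_ge0// ltW// da_weight_gt0.
pose G al k := 2 * C ^+ 2 * (Num.sqrt (al j + k).+1%:R ^+ 3)^-1 *
     Num.sqrt (al j).+1%:R * g al.
have G0 al k : 0 <= G al k.
  apply: mulr_ge0 (g0 al); apply: mulr_ge0 (sqrtr_ge0 _).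
  by rewrite divr_ge0 ?exprn_ge0 ?sqrtr_ge0// mulr_ge0 ?sqr_ge0.
apply: (@le_trans _ _ (\esum_(al in [set: mindex d])
    \sum_(0 <= k < (al j).+1) (G (msub j k al) k)%:E)%E).
  apply: le_esum => al _; rewrite sumEFin lee_fin; exact: rhaly_term_le.
rewrite (@esum_madd _ _ _ (fun al k => (G al k)%:E)); last first.
  by move=> al k; rewrite lee_fin.
(* The constant is absorbed into the series as the scalar sqrt 8 * C, which makes the comparison
   termwise. *)
have := da_sqnormZ (Num.sqrt 8 * C)%:C%C f.
rewrite normc_real real_normK ?num_real// exprMn sqr_sqrtr// => <-.
apply: le_esum => al _.
rewrite -nneseries_esumT; last by move=> k; rewrite lee_fin.
apply: lime_le; first by apply: is_cvg_nneseries => k _ _; rewrite lee_fin.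
apply: nearW => K; rewrite sumEFin lee_fin.
rewrite [normc _](_ : _ = Num.sqrt 8 * `|C| * normc (f al)); last first.
  by rewrite normcM normc_real normrM (ger0_norm (sqrtr_ge0 _)).
rewrite !exprMn sqr_sqrtr// real_normK ?num_real//.
rewrite /G -!mulr_suml -mulr_sumr.
rewrite [leRHS](_ : _ = 8 * C ^+ 2 * g al); last by rewrite /g !mulrA.
rewrite ler_wpM2r//.
have s0 : 0 < Num.sqrt (al j).+1%:R :> R by rewrite sqrtr_gt0 ltr0n.
have := sum_inv_pow32_le R (al j) K; rewrite ler_pdivlMr// => h.
have := sqr_ge0 C; nra.
Qed.

End RhalyBound.

(** * Norms and finite partial sums *)

Section DaNorm.
Variables (R : realType) (d : nat).
Implicit Types (f g : fps R d) (al : mindex d).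

Lemma da_norm_le f g (M : R) : 0 <= M -> f \in @in_da R d ->
  (da_sqnorm g <= (M ^+ 2)%:E * da_sqnorm f)%E ->
  g \in @in_da R d /\ da_norm g <= M * da_norm f.
Proof.
move=> M0 ff gf; have gg : g \in @in_da R d.
  rewrite inE; apply: le_lt_trans gf _.
  by rewrite -(sqr_da_norm ff) -EFinM ltry.
split => //; move: gf; rewrite -!sqr_da_norm// -EFinM lee_fin -exprMn.
by rewrite ler_pXn2r// nnegrE ?mulr_ge0// da_norm_ge0.
Qed.

Lemma da_sqnorm_fset f (A : {fset mindex d}) :
  (forall al, al \notin A -> f al = 0) ->
  da_sqnorm f = (\sum_(al <- A) normc (f al) ^+ 2 * da_weight R al)%:E.
Proof.
move=> fA; transitivity (\esum_(al in [set` A])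
    (normc (f al) ^+ 2 * da_weight R al)%:E)%E.
  rewrite [RHS]esum_mkcond; apply: eq_esum => al _; case: ifPn => //.
  by rewrite notin_setE/= => /negP /fA ->; rewrite normc0 expr0n mul0r.
rewrite esum_fset//; last first.
  by move=> al _; rewrite lee_fin mulr_ge0 ?sqr_ge0// ltW// da_weight_gt0.
by rewrite fsbig_finite// set_fsetK sumEFin.
Qed.

Lemma le_da_sqnorm_fset f (A : {fset mindex d}) :
  ((\sum_(al <- A) normc (f al) ^+ 2 * da_weight R al)%:E <= da_sqnorm f)%E.
Proof.
apply: ereal_sup_ubound; exists [set` A]; first by split.
by rewrite fsbig_finite// set_fsetK sumEFin.
Qed.

Lemma da_sqnorm_le f (c : R) :
  (forall A : {fset mindex d},
    \sum_(al <- A) normc (f al) ^+ 2 * da_weight R al <= c) ->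
  (da_sqnorm f <= c%:E)%E.
Proof.
move=> fc; apply: ge_ereal_sup => _ [A [finA _] <-].
by rewrite fsbig_finite// sumEFin lee_fin.
Qed.

End DaNorm.

(** * Boundedness, and the splitting into head and tail *)

Section RhalyNorm.
Variables (R : realType) (d : nat) (j : 'I_d).
Implicit Types (f g : fps R d) (al : mindex d) (a : nat -> R[i]).

Lemma da_norm_rhaly_le a (C : R) f :
  (forall n, n.+1%:R * normc (a n) <= C) -> f \in @in_da R d ->
  rhaly j a f \in @in_da R d /\ da_norm (rhaly j a f) <= 3 * C * da_norm f.
Proof.
move=> aC ff.
have C0 : 0 <= C by apply: le_trans (aC 0%N); rewrite mulr_ge0 ?normc_ge0.
apply: da_norm_le => //; first by rewrite mulr_ge0.
apply: le_trans (da_sqnorm_rhaly_le _ _ aC) _.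
(* The constant 3 is sqrt 8 rounded up: 8 <= 3^2. *)
rewrite lee_wpmul2r ?da_sqnorm_ge0// lee_fin exprMn ler_wpM2r ?sqr_ge0//.
by rewrite -natrX ler_nat.
Qed.

Lemma da_bounded_rhaly a (C : R) :
  (forall n, n.+1%:R * normc (a n) <= C) -> da_bounded (rhaly j a).
Proof.
move=> aC; split=> [f ff|]; first by have [] := da_norm_rhaly_le aC ff.
(* C may be 0, whereas the bound must be positive. *)
exists (3 * (C + 1)) => [|f ff].
  rewrite mulr_gt0// ltr_wpDl//.
  by apply: le_trans (aC 0%N); rewrite mulr_ge0 ?normc_ge0.
apply: le_trans (proj2 (da_norm_rhaly_le aC ff)) _.
by rewrite ler_wpM2r ?da_norm_ge0// ler_wpM2l// lerDl.
Qed.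

Lemma rhaly_linear a : linear (rhaly j a : fps R d -> fps R d).
Proof.
move=> c f g; apply/funext => al.
rewrite [RHS]/(c * rhaly j a f al + rhaly j a g al).
rewrite !rhalyE; under eq_bigr do
  rewrite -[(_ + _) _]/(c * f (msub j _ al) + g (msub j _ al)).
rewrite big_split/= -mulr_sumr mulrDr; congr (_ + _); exact: mulrCA.
Qed.

Definition da_trunc (N : nat) f : fps R d :=
  fun al => if (mdeg al < N)%N then f al else 0.

(** The coefficient of R f at al involves f only in degrees at most |al|, so the head, where |al| <
    N, sees only the truncation of f. *)
Lemma rhaly_split a N f :
  rhaly j a f = rhaly j (fun n => if (n < N)%N then a n else 0) (da_trunc N f)
              + rhaly j (fun n => if (n < N)%N then 0 else a n) f.
Proof.
apply/funext => al; rewrite addrfctE !rhalyE.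
case: ifPn => alN; rewrite mul0r ?add0r// addr0; congr (_ * _).
apply: eq_big_nat => k; rewrite ltnS /= => kal.
by rewrite /da_trunc mdeg_msub// (leq_ltn_trans (leq_subr _ _) alN).
Qed.

(** For compactness: the first term depends on finitely many coefficients of f, and the second is
    uniformly small on balls when e is small. *)
Lemma da_norm_rhaly_split_le a (C e : R) N f :
  (forall n, n.+1%:R * normc (a n) <= C) ->
  0 <= e -> (forall n, (N <= n)%N -> n.+1%:R * normc (a n) <= e) ->
  f \in @in_da R d -> da_trunc N f \in @in_da R d ->
  da_norm (rhaly j a f) <= 3 * C * da_norm (da_trunc N f) + 3 * e * da_norm f.
Proof.
move=> aC e0 ae ff tf; rewrite (rhaly_split a N).
have C0 : 0 <= C by apply: le_trans (aC 0%N); rewrite mulr_ge0 ?normc_ge0.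
have [] := @da_norm_rhaly_le (fun n => if (n < N)%N then a n else 0) C _ _ tf.
  by move=> n; case: ifPn => // _; rewrite normc0 mulr0.
move=> hin h.
have [] := @da_norm_rhaly_le (fun n => if (n < N)%N then 0 else a n) e _ _ ff.
  by move=> n; case: ltnP => // [_|/ae//]; rewrite normc0 mulr0.
by move=> tin t; apply: le_trans (da_normD hin tin) _; exact: lerD.
Qed.

End RhalyNorm.

(** * Test polynomials in z_j and unboundedness *)

Section Unbounded.
Variables (R : realType) (d : nat) (j : 'I_d).

(** The exponent of the monomial z_j^k. Its weight is 1, so on polynomials in z_j the norm is the
    l^2 norm of the coefficients. *)
Let e k : mindex d := madd j k [ffun=> 0%N].

Let mdeg_e k : mdeg (e k) = k.
Proof. by rewrite mdeg_madd /mdeg big1// => i _; rewrite ffunE. Qed.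

Let e_j k : e k j = k.
Proof. by rewrite madd_j ffunE. Qed.

Let mfact_e k : mfact (e k) = k`!.
Proof.
elim: k => [|k IH]; last by rewrite /e maddS mfact_madd1 -/(e k) e_j IH factS.
by rewrite /e madd0 /mfact big1// => i _; rewrite ffunE.
Qed.

Let weight_e k : da_weight R (e k) = 1.
Proof.
by rewrite /da_weight mfact_e mdeg_e divff// pnatr_eq0 -lt0n fact_gt0.
Qed.

Let msub_e k m : (k <= m)%N -> msub j k (e m) = e (m - k).
Proof.
by move=> km; apply/ffunP => i; rewrite !ffunE; case: eqP.
Qed.

Let e_inj : injective e.
Proof. by move=> k l /(congr1 (@mdeg d)); rewrite !mdeg_e. Qed.

(* The coefficients of 1 + z_j + ... + z_j^(n-1). *)
Definition zX_sum (n : nat) : fps R d :=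
  fun al => if al \in [fset e k | k in iota 0 n]%fset then 1 else 0.

Let sum_e n (F : mindex d -> R) :
  \sum_(al <- [fset e k | k in iota 0 n]%fset) F al = \sum_(0 <= k < n) F (e k).
Proof.
rewrite big_imfset/=; last by move=> k l _ _; exact: e_inj.
by rewrite undup_id ?iota_uniq// /index_iota subn0.
Qed.

Let zX_sum_e n k : (k < n)%N -> zX_sum n (e k) = 1.
Proof. by move=> kn; rewrite /zX_sum in_imfset//= mem_iota. Qed.

Lemma da_sqnorm_zX_sum n : da_sqnorm (zX_sum n) = n%:R%:E.
Proof.
rewrite (@da_sqnorm_fset _ _ _ [fset e k | k in iota 0 n]%fset); last first.
  by move=> al aln; rewrite /zX_sum (negbTE aln).
rewrite sum_e; under eq_big_nat => k /andP[_ kn] do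
  rewrite zX_sum_e// normc1 weight_e mulr1 expr1n.
by rewrite sumr_const_nat subn0.
Qed.

(** For k < n, the coefficient of the image at z_j^k collects k + 1 ones and equals (k + 1) a_k; all
    other coefficients are dropped. *)
Lemma da_sqnorm_rhaly_zX_sum_ge (a : nat -> R[i]) n :
  ((\sum_(0 <= k < n) (k.+1%:R * normc (a k)) ^+ 2)%:E <=
   da_sqnorm (rhaly j a (zX_sum n)))%E.
Proof.
apply: le_trans (le_da_sqnorm_fset _ [fset e k | k in iota 0 n]%fset).
rewrite lee_fin sum_e le_eqVlt; apply/orP; left; apply/eqP.
apply: eq_big_nat => k /andP[_ kn]; rewrite weight_e mulr1 rhalyE mdeg_e.
rewrite e_j (@eq_big_nat _ _ _ _ _ _ (fun=> 1)); last first.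
  move=> l /=; rewrite ltnS => lk.
  by rewrite msub_e// zX_sum_e// (leq_ltn_trans (leq_subr _ _)).
rewrite sumr_const_nat subn0 normcM mulrC; congr ((_ * _) ^+ 2).
by rewrite -(rmorph_nat (real_complex R)) normc_real normr_nat.
Qed.

Lemma rhaly_unbounded (a : nat -> R[i]) :
  (forall K, \forall n \near \oo, K <= n.+1%:R * normc (a n)) ->
  ~ da_bounded (rhaly j a).
Proof.
move=> aoo [Tin [M M0 TM]].
have [N _ aN] := aoo (2 * M).
(* The N + 1 terms of the upper half are each at least (2 M)^2, for a total of 4 M^2 (N + 1),
   whereas boundedness allows only M^2 n = 2 M^2 (N + 1). *)
pose n := (N.+1 + N.+1)%N.
have fin : zX_sum n \in @in_da R d by rewrite inE/= da_sqnorm_zX_sum ltry.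
have := TM _ fin.
rewrite -(@ler_pXn2r _ 2)// ?nnegrE ?mulr_ge0 ?da_norm_ge0//; last exact: ltW.
rewrite exprMn -lee_fin (EFinM (M ^+ 2)) !sqr_da_norm ?Tin//.
rewrite da_sqnorm_zX_sum => h.
have := le_trans (da_sqnorm_rhaly_zX_sum_ge a n) h.
rewrite -EFinM lee_fin leNgt => /negP; apply.
rewrite (@big_cat_nat _ _ _ N.+1)//=; last by rewrite leq_addr.
apply: (@lt_le_trans _ _ (0 + \sum_(N.+1 <= k < n) (2 * M) ^+ 2)); last first.
  apply: lerD; first by apply: sumr_ge0 => k _; exact: sqr_ge0.
  apply: ler_sum_nat => k /andP[Nk _].
  have h2 := aN k (ltnW Nk).
  have M20 : 0 <= 2 * M by rewrite mulr_ge0// ltW.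
  by rewrite lerXn2r ?nnegrE// (le_trans M20).
rewrite add0r sumr_const_nat addnK -[ltRHS]mulr_natr natrD exprMn.
have : 0 < M ^+ 2 * N.+1%:R by rewrite mulr_gt0 ?exprn_gt0.
move: (M ^+ 2) (N.+1%:R : R) => x y xy.
rewrite -subr_gt0 (_ : _ - _ = 2 * (x * y)); last by ring.
by rewrite mulr_gt0.
Qed.

End Unbounded.

(** * Limits of real expressions along a filter *)

Lemma cvg_sqr_sub (R : realType) (T : Type) (F : set_system T) (u : T -> R)
    (l c : R) : Filter F ->
  u x @[x --> F] --> l -> (u x - c) ^+ 2 @[x --> F] --> (l - c) ^+ 2.
Proof.
move=> FF ul; have h : u x - c @[x --> F] --> l - c.
  by apply: cvgB => //; exact: cvg_cst.
rewrite expr2; under eq_cvg do rewrite expr2.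
exact: cvgM.
Qed.

Lemma cvgMDr (R : realType) (T : Type) (F : set_system T) (u v : T -> R)
    (l m c : R) : Filter F ->
  u x @[x --> F] --> l -> v x @[x --> F] --> m ->
  (u x + v x) * c @[x --> F] --> (l + m) * c.
Proof. by move=> FF ul vm; apply: cvgMr_tmp; exact: cvgD. Qed.

Lemma cvg_sumr (R : realType) (T : Type) (F : set_system T) (I : Type)
    (r : seq I) (u : I -> T -> R) (l : I -> R) : Filter F ->
  (forall i, u i x @[x --> F] --> l i) ->
  \sum_(i <- r) u i x @[x --> F] --> \sum_(i <- r) l i.
Proof. by move=> FF ul; apply: (@cvg_big R I +%R 0 predT add_continuous). Qed.

(** * Compactness of balls for coefficientwise convergence *)

Section Compactness.
Variables (R : realType) (d : nat).
Implicit Types (f : fps R d) (al : mindex d).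

Local Notation coefs := (prod_topology (fun _ : mindex d * bool => R)).

(** Real parts ([false]) and imaginary parts ([true]) are separate coordinates, so that Tychonoff's
    theorem applies to a product of real segments. *)
Definition fps_of_coefs (h : coefs) : fps R d :=
  fun al => (h (al, false) +i* h (al, true))%C.

Definition coefs_of_fps f : coefs :=
  fun p => if p.2 then complex.Im (f p.1) else complex.Re (f p.1).

Lemma coefs_of_fpsK f : fps_of_coefs (coefs_of_fps f) = f.
Proof.
by apply/funext => al; rewrite /fps_of_coefs /coefs_of_fps /=; case: (f al).
Qed.

Lemma sqr_normc_sub_coefs (h h' : coefs) al :
  normc ((fps_of_coefs h - fps_of_coefs h') al) ^+ 2 =
  (h (al, false) - h' (al, false)) ^+ 2 + (h (al, true) - h' (al, true)) ^+ 2.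
Proof.
rewrite (_ : (_ - _) al = ((h (al, false) - h' (al, false)) +i*
  (h (al, true) - h' (al, true)))%C)//.
by rewrite /normc/= sqr_sqrtr// addr_ge0 ?sqr_ge0.
Qed.

(** Only finitely many coordinates occur. The centre 0 serves to show that balls are closed, the
    centre h to build neighbourhoods of h. *)
Lemma continuous_sum_coefs (A : {fset mindex d}) (h' : coefs) :
  continuous (fun h : coefs => \sum_(al <- A)
    normc ((fps_of_coefs h - fps_of_coefs h') al) ^+ 2 * da_weight R al).
Proof.
have cp al b (h : coefs) :
    (x (al, b) - h' (al, b)) ^+ 2 @[x --> h] --> (h (al, b) - h' (al, b)) ^+ 2.
  have c := (@proj_continuous _ (fun _ : mindex d * bool => R) (al, b) h).
  exact: (@cvg_sqr_sub R coefs (nbhs h) (fun x : coefs => x (al, b)) _ _ _ c).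
move=> h; rewrite /continuous_at.
apply: (@cvg_sumr R coefs (nbhs h) _ (enum_fset A)
  (fun al (x : coefs) =>
     normc ((fps_of_coefs x - fps_of_coefs h') al) ^+ 2 * da_weight R al)
  (fun al =>
     normc ((fps_of_coefs h - fps_of_coefs h') al) ^+ 2 * da_weight R al))
  => al.
rewrite sqr_normc_sub_coefs.
under eq_cvg do rewrite sqr_normc_sub_coefs.
exact: (@cvgMDr R coefs (nbhs h) _ _ _ _ _ _ (cp al false h) (cp al true h)).
Qed.

Definition da_coef_ball (r : R) : set coefs :=
  [set h | (da_sqnorm (fps_of_coefs h) <= (r ^+ 2)%:E)%E].

(** The squared norm is a supremum of finite sums, so the ball is an intersection of sets that are
    closed by [continuous_sum_coefs]. *)
Lemma da_coef_ballE r : da_coef_ball r = \bigcap_(A in [set: {fset mindex d}])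
  [set h | \sum_(al <- A) normc (fps_of_coefs h al) ^+ 2 * da_weight R al
           <= r ^+ 2].
Proof.
apply/seteqP; split=> h /=; rewrite /da_coef_ball/=.
  move=> hr A _; rewrite /= -lee_fin; apply: (le_trans _ hr).
  exact: le_da_sqnorm_fset.
by move=> hr; apply: da_sqnorm_le => A; exact: hr.
Qed.

Lemma compact_da_coef_ball r : compact (da_coef_ball r).
Proof.
(* A coordinate of absolute value y satisfies y^2 <= c with c = r^2 / [da_weight R al]; then 2 y <=
   y^2 + 1 gives y <= c + 1. *)
pose B al := r ^+ 2 / da_weight R al + 1.
pose box (p : mindex d * bool) : set R := [set` `[- B p.1, B p.1]].
apply: (@subclosed_compact _ _ [set h : coefs | forall p, box p (h p)]).
- rewrite da_coef_ballE; apply: closed_bigI => A _.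
  pose z : coefs := fun=> 0.
  have zE h al : fps_of_coefs h al = (fps_of_coefs h - fps_of_coefs z) al.
    by rewrite -[RHS]/(_ - _) /fps_of_coefs/= subr0.
  have /continuous_closedP/(_ _ (@closed_le _ (r ^+ 2))) :=
    @continuous_sum_coefs A z.
  move=> h; rewrite (_ : [set _ | _] = (fun h : coefs => \sum_(al <- A)
    normc ((fps_of_coefs h - fps_of_coefs z) al) ^+ 2 * da_weight R al) @^-1`
    [set x | x <= r ^+ 2]) //.
  apply/funext => y; rewrite /preimage/mkset; congr (is_true (_ <= _)).
  by apply: eq_bigr => al _; rewrite zE.
- apply: (@tychonoff _ (fun _ => R)) => p; exact: segment_compact.
- move=> h hr [al b]; rewrite /box/= in_itv/=.
  have w0 : 0 < da_weight R al by exact: da_weight_gt0.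
  have h1 : \sum_(al <- [fset al]%fset)
      normc (fps_of_coefs h al) ^+ 2 * da_weight R al <= r ^+ 2.
    rewrite -lee_fin; apply: le_trans hr; exact: le_da_sqnorm_fset.
  move: h1; rewrite big_seq_fset1 -ler_pdivlMr//.
  rewrite [normc _ ^+ 2](_ : _ =
    h (al, false) ^+ 2 + h (al, true) ^+ 2); last first.
    by rewrite /normc/= sqr_sqrtr// addr_ge0 ?sqr_ge0.
  move=> hB; rewrite -ler_norml /B.
  have hb : h (al, b) ^+ 2 <= r ^+ 2 / da_weight R al.
    apply: le_trans hB; case: (b); first by rewrite lerDr sqr_ge0.
    by rewrite lerDl sqr_ge0.
  move: hb; move: (h (al, b)) => x.
rewrite -[x ^+ 2]real_normK ?num_real//.
  move: (r ^+ 2 / _) `|_| (normr_ge0 x) => c y y0 xc.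
  have := sqr_ge0 (y - 1); rewrite sqrrB1 => ?; lra.
Qed.

End Compactness.

(** * Compactness of the Rhaly operator *)

Section RhalyCompact.
Variables (R : realType) (d : nat) (j : 'I_d) (a : nat -> R[i]) (C : R).
Hypothesis aC : forall n, n.+1%:R * normc (a n) <= C.

Let rhaly_in_da (f : druryArveson R d) : rhaly j a f \in @in_da R d.
Proof. by have [] := da_norm_rhaly_le j aC (da_seriesP f). Qed.

Definition da_rhaly (f : druryArveson R d) : druryArveson R d :=
  DruryArveson (rhaly_in_da f).

Let da_rhaly_linear : linear da_rhaly.
Proof. by move=> c f g; apply/val_inj; exact: rhaly_linear. Qed.

HB.instance Definition _ :=
  GRing.isLinear.Build R[i] (druryArveson R d) (druryArveson R d) _ da_rhaly
    da_rhaly_linear.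

Local Notation coefs := (prod_topology (fun _ : mindex d * bool => R)).

(** Families outside the space are replaced by the default 0; this never happens on
    [da_coef_ball r], where continuity is proved. *)
Definition da_rhaly_of_coefs (h : coefs) : druryArveson R d :=
  da_rhaly (insubd (0 : druryArveson R d) (fps_of_coefs h)).

Hypothesis a0 : forall e, 0 < e ->
  \forall n \near \oo, n.+1%:R * normc (a n) <= e.

(* The head of R only involves finitely many coefficients and its tail is
   uniformly small on the ball. *)
Lemma da_rhaly_of_coefs_continuous r :
  {within da_coef_ball r, continuous da_rhaly_of_coefs}.
Proof.
apply/subspace_continuousP => h hr.
have in_ball h' : da_coef_ball r h' -> fps_of_coefs h' \in @in_da R d.
  by move=> h'r; rewrite inE; apply: le_lt_trans h'r _; rewrite ltry.
have norm_ball (h' : coefs) :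
    da_coef_ball r h' -> da_norm (fps_of_coefs h') <= `|r|.
  move=> h'r; rewrite -(@ler_pXn2r _ 2)// ?nnegrE ?da_norm_ge0//.
  by rewrite -lee_fin sqr_da_norm ?in_ball// real_normK ?num_real.
have C0 : 0 <= C by apply: le_trans (aC 0%N); rewrite mulr_ge0 ?normc_ge0.
(* The norm takes values in [R[i]], so the tolerance is complex; its positivity makes it real. *)
apply/cvgrPdist_lt => -[e ei]; rewrite ltcE/= => /andP[/eqP -> e0].
(* Chosen so that 3 (C + 1) dl = e / 2 for the head and 3 ep * 2 (|r| + 1) = e / 2 for the tail;
   adding 1 keeps the denominators positive. *)
pose dl := e / (6 * (C + 1)).
have dl0 : 0 < dl by rewrite divr_gt0// mulr_gt0// ltr_wpDl.
pose ep := e / (12 * (`|r| + 1)).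
have ep0 : 0 < ep by rewrite divr_gt0// mulr_gt0// ltr_wpDl.
have [N _ aN] := a0 ep0.
pose A : {fset mindex d} := fset_set [set al : mindex d | (mdeg al < N)%N].
have AE al : (al \in A) = (mdeg al < N)%N.
  rewrite in_fset_set; last exact: finite_mdeg_lt.
  by apply/idP/idP; rewrite inE.
have hA : \forall h' \near h, \sum_(al <- A)
    normc ((fps_of_coefs h' - fps_of_coefs h) al) ^+ 2 * da_weight R al
    < dl ^+ 2.
  have := @continuous_sum_coefs R d A h h.
  rewrite /continuous_at [X in _ --> X](_ : _ = 0); last first.
    by apply: big1 => al _; rewrite subrr normc0 expr0n mul0r.
  by move=> /cvgr_lt; apply; rewrite exprn_gt0.
rewrite near_withinE; apply: filterS hA => h' hA h'r.
pose f := fps_of_coefs h - fps_of_coefs h'.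
have ff : f \in @in_da R d by rewrite rpredB ?in_ball.
have fr : da_norm f <= 2 * `|r|.
  rewrite mulr_natl mulr2n.
  apply: le_trans (da_normD _ _) _; rewrite ?rpredN ?in_ball//.
  rewrite lerD ?norm_ball// -scaleN1r da_normZ ?in_ball//.
  by rewrite normcN normc1 mul1r norm_ball.
(* The truncation is supported on A, so its squared norm is the finite sum controlled by hA. *)
have [tf ft] : da_trunc N f \in @in_da R d /\ da_norm (da_trunc N f) < dl.
  have E : da_sqnorm (da_trunc N f) = (\sum_(al <- A)
      normc ((fps_of_coefs h' - fps_of_coefs h) al) ^+ 2 * da_weight R al)%:E.
    rewrite (@da_sqnorm_fset _ _ _ A).
      congr (_ %:E); rewrite big_seq [RHS]big_seq; apply: eq_bigr => al.
      rewrite AE /da_trunc => ->; rewrite -normcN; congr (normc _ ^+ 2 * _).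
      exact: opprB.
    by move=> al; rewrite AE /da_trunc => /negbTE ->.
  have tf : da_trunc N f \in @in_da R d by rewrite inE/= E ltry.
  split=> //; rewrite -(@ltr_pXn2r _ 2)// ?nnegrE ?da_norm_ge0 ?ltW//.
  by rewrite -lte_fin sqr_da_norm// E lte_fin.
rewrite /da_rhaly_of_coefs -raddfB/= da_normE -[da_series _]/(rhaly j a _).
rewrite [da_series _](_ : _ = f); last first.
  by rewrite -[LHS]/(da_series _ - da_series _) /f !insubdK ?in_ball.
rewrite -[(_ +i* _)%C]/(e%:C%C) ltcR.
apply: le_lt_trans (da_norm_rhaly_split_le j aC (ltW ep0) aN ff tf) _.
apply: (@lt_le_trans _ _ (e / 2 + e / 2)); last by lra.
apply: ltr_leD.
  apply: (@le_lt_trans _ _ (3 * C * dl)).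
    by rewrite ler_wpM2l ?mulr_ge0// ltW.
  rewrite (_ : e / 2 = 3 * (C + 1) * dl); last by rewrite /dl; field; lra.
  by rewrite ltr_pM2r// ltr_pM2l// ltrDl.
apply: (@le_trans _ _ (3 * ep * (2 * `|r|))).
  by rewrite ler_wpM2l// mulr_ge0// ltW.
rewrite (_ : e / 2 = 3 * ep * (2 * (`|r| + 1))); last first.
  by rewrite /ep; field; have := normr_ge0 r; lra.
by rewrite ler_pM2l ?mulr_gt0// ler_pM2l// lerDl.
Qed.

(** The image of a bounded set lies in the continuous image of a compact coefficient ball. *)
Lemma da_compact_rhaly : da_compact (rhaly j a).
Proof.
exists da_rhaly; first by [].
move=> A /(pinfty_ex_gt (real0 _))[M _ AM].
(* The bound M lives in [R[i]]; its real part is the radius. *)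
pose r := complex.Re M.
have Ar f : A f -> da_coef_ball r (coefs_of_fps f).
  move=> /AM/=; rewrite da_normE lecE/= => /andP[_ fr].
  rewrite /da_coef_ball/= coefs_of_fpsK -sqr_da_norm ?da_seriesP// lee_fin.
  by rewrite lerXn2r ?nnegrE ?da_norm_ge0// (le_trans (da_norm_ge0 _) fr).
apply: (@precompact_subset _ _ (da_rhaly_of_coefs @` da_coef_ball r)).
  move=> _ [f Af <-]; exists (coefs_of_fps f); first exact: Ar.
  rewrite /da_rhaly_of_coefs coefs_of_fpsK; congr da_rhaly.
  by apply/val_inj; rewrite insubdK// da_seriesP.
apply: compact_precompact; first exact: norm_hausdorff.
apply: continuous_compact; first exact: da_rhaly_of_coefs_continuous.
exact: compact_da_coef_ball.
Qed.

End RhalyCompact.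

(** * From the limit L to bounds on (n + 1) a_n, and the three cases *)

Theorem theorem4p13 (R : realType) (d : nat) (hd : (1 <= d)%N) (j : 'I_d)
    (a : nat -> R) (a_ge0 : forall n, 0 <= a n)
    (L : \bar R) (aL : (n.+1%:R * a n)%:E @[n --> \oo] --> L) :
  [/\ (L < +oo)%E -> da_bounded (rhaly j (fun n => (a n)%:C%C)),
      L = +oo%E -> ~ da_bounded (rhaly j (fun n => (a n)%:C%C)) &
      L = 0%E -> da_compact (rhaly j (fun n => (a n)%:C%C))].
Proof.
have normE n : n.+1%:R * normc (a n)%:C%C = n.+1%:R * a n.
  by rewrite normc_real ger0_norm.
have evt (b : R) : (L < b%:E)%E ->
    \forall n \near \oo, n.+1%:R * normc (a n)%:C%C <= b.
  move=> Lb; have : \forall n \near \oo, ((n.+1%:R * a n)%:E < b%:E)%E.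
    exact: aL (open_ereal_lt' Lb).
  by apply: filterS => n; rewrite normE lte_fin => /ltW.
have bnd : (L < +oo)%E -> exists C, forall n, n.+1%:R * normc (a n)%:C%C <= C.
  move=> Loo; have [b Lb] : exists b : R, (L < b%:E)%E.
    case: L Loo {aL evt} => [x| |]// _; last by exists 0; rewrite ltNyr.
    by exists (x + 1); rewrite lte_fin ltrDl.
  have [N _ aN] := evt _ Lb.
  (* The eventual bound b is made global: each of the first N terms is at most their sum, all of
     them being nonnegative, and |b| covers either sign of b. *)
  exists (`|b| + \sum_(0 <= k < N) k.+1%:R * a k) => n.
  have S0 P : 0 <= \sum_(0 <= k < N | P k) k.+1%:R * a k.
    by apply: sumr_ge0 => k _; rewrite mulr_ge0.
  have [nN|Nn] := ltnP n N.
    rewrite ler_wpDl// normE big_mkord (bigD1 (Ordinal nN))//= lerDl.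
    by apply: sumr_ge0 => k _; rewrite mulr_ge0.
  by rewrite ler_wpDr// (le_trans (aN _ Nn))// ler_norm.
split=> [Loo|Loo|L0].
- by have [C aC] := bnd Loo; exact: da_bounded_rhaly aC.
- apply: rhaly_unbounded => K; move: aL; rewrite Loo => /cvgeyPge/(_ K).
  by apply: filterS => n; rewrite normE lee_fin.
- have [C aC] : exists C, forall n, n.+1%:R * normc (a n)%:C%C <= C.
    by apply: bnd; rewrite L0 ltry.
  by apply: (da_compact_rhaly j aC) => e e0; apply: evt; rewrite L0 lte_fin.
Qed.
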